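(* Let $d \ge 1$ and let $\mathbf{u}, \mathbf{v} \in \mathbb{R}^d$ with $\mathbf{u}\cdot\mathbf{v} \neq 0$. Then $$|\mathbf{u}\cdot\mathbf{v}| \;\le\; \left|\mathbf{u}^{\uparrow}\cdot\mathbf{v}^{\updownarrow}\right| \;\le\; \|\mathbf{u}\|\,\|\mathbf{v}\| \;\le\; \tfrac12\left(\|\mathbf{u}\|^2+\|\mathbf{v}\|^2\right),$$ and the equality conditions are as follows. (1) $|\mathbf{u}\cdot\mathbf{v}| = |\mathbf{u}^{\uparrow}\cdot\mathbf{v}^{\updownarrow}|$ if and only if either $\mathbf{u}\cdot\mathbf{v}>0$ and $\mathbf{u},\mathbf{v}$ are similar vectors, or $\mathbf{u}\cdot\mathbf{v}<0$ and $\mathbf{u},\mathbf{v}$ are discordant vectors. (2) $|\mathbf{u}\cdot\mathbf{v}| = \|\mathbf{u}\|\|\mathbf{v}\|$ if and only if $\mathbf{u}$ and $\mathbf{v}$ are linearly dependent, i.e., there exists a scalar $k\in\mathbb{R}$ such that $\mathbf{v}=k\mathbf{u}$. (3) $|\mathbf{u}\cdot\mathbf{v}| = \frac12(\|\mathbf{u}\|^2+\|\mathbf{v}\|^2)$ if and only if $\mathbf{u}=\mathbf{v}$ or $\mathbf{u}=-\mathbf{v}$. (4) $|\mathbf{u}^{\uparrow}\cdot\mathbf{v}^{\updownarrow}| = \|\mathbf{u}\|\|\mathbf{v}\|$ if and only if there exist a scalar $k\in\mathbb{R}$ and a $d\times d$ permutation matrix $P$ such that $\mathbf{v}=kP\mathbf{u}$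 and $\operatorname{sgn}(\mathbf{u}\cdot\mathbf{v})=\operatorname{sgn}(k)$. (5) $|\mathbf{u}^{\uparrow}\cdot\mathbf{v}^{\updownarrow}| = \frac12(\|\mathbf{u}\|^2+\|\mathbf{v}\|^2)$ if and only if there exist a scalar $k\in\{1,-1\}$ and a $d\times d$ permutation matrix $P$ such that $\mathbf{v}=kP\mathbf{u}$ and $\operatorname{sgn}(\mathbf{u}\cdot\mathbf{v})=\operatorname{sgn}(k)$. (6) $\|\mathbf{u}\|\|\mathbf{v}\| = \frac12(\|\mathbf{u}\|^2+\|\mathbf{v}\|^2)$ if and only if $\|\mathbf{u}\|=\|\mathbf{v}\|$.
   Context: For $\mathbf{u}=(u_1,\dots,u_d)$, $\mathbf{v}=(v_1,\dots,v_d)$ in $\mathbb{R}^d$, $\mathbf{u}\cdot\mathbf{v}=\sum_{i=1}^d u_iv_i$ and $\|\mathbf{u}\|=\sqrt{\sum_{i=1}^d u_i^2}$. $\mathbf{u}$ and $\mathbf{v}$ are similar vectors if $(u_i-u_j)(v_i-v_j)\ge 0$ for all $1\le i,j\le d$. They are discordant vectors if $(u_i-u_j)(v_i-v_j)\le 0$ for all $1\le i,j\le d$. For a vector $\mathbf{w}\in\mathbb{R}^d$, $\mathbf{w}^{\uparrow}$ denotes the vector obtained by sorting the components of $\mathbf{w}$ in non-decreasing order, and $\mathbf{w}^{\downarrow}$ the vector obtained by sorting them in non-increasing order. Given $\mathbf{u},\mathbf{v}$ with $\mathbf{u}\cdot\mathbf{v}\ne 0$, the vector $\mathbf{v}^{\updownarrow}$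 (which depends on $\mathbf{u}$ as well) is defined as $\mathbf{v}^{\updownarrow}=\mathbf{v}^{\uparrow}$ if $\mathbf{u}\cdot\mathbf{v}>0$ and $\mathbf{v}^{\updownarrow}=\mathbf{v}^{\downarrow}$ if $\mathbf{u}\cdot\mathbf{v}<0$. *)

(* Defs.v *)
(* The real numbers are an arbitrary [R : realType], and R^d is the type of
   column vectors, so that matrices act on the left. *)
From HB Require Import structures.
From mathcomp Require Import all_boot all_order all_algebra.
From mathcomp Require Import reals.

Set Implicit Arguments.
Unset Strict Implicit.
Unset Printing Implicit Defensive.

Import Order.TTheory GRing.Theory Num.Theory.
Local Open Scope ring_scope.

Definition dot (R : realType) (d : nat) (u v : 'cV[R]_d) : R :=
  \sum_(i < d) u i 0 * v i 0.

(* Not the canonical norm on matrices, which is the sup norm. *)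
Definition enorm (R : realType) (d : nat) (u : 'cV[R]_d) : R :=
  Num.sqrt (\sum_(i < d) u i 0 ^+ 2).

Definition similar_vectors (R : realType) (d : nat) (u v : 'cV[R]_d) : Prop :=
  forall i j : 'I_d, 0 <= (u i 0 - u j 0) * (v i 0 - v j 0).

Definition discordant_vectors (R : realType) (d : nat) (u v : 'cV[R]_d) :
    Prop :=
  forall i j : 'I_d, (u i 0 - u j 0) * (v i 0 - v j 0) <= 0.

Definition components (R : realType) (d : nat) (w : 'cV[R]_d) : seq R :=
  [seq w i 0 | i <- enum 'I_d].

(* [components w] has size [d], so the default of [nth] is never reached. *)
Definition sort_up (R : realType) (d : nat) (w : 'cV[R]_d) : 'cV[R]_d :=
  \col_(i < d) nth 0 (sort (fun x y : R => x <= y) (components w)) i.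

Definition sort_down (R : realType) (d : nat) (w : 'cV[R]_d) : 'cV[R]_d :=
  \col_(i < d) nth 0 (sort (fun x y : R => y <= x) (components w)) i.

(* Meaningful only when [dot u v != 0]: the [else] branch is then the case
   [dot u v < 0]. *)
Definition sort_updown (R : realType) (d : nat) (u v : 'cV[R]_d) : 'cV[R]_d :=
  if 0 < dot u v then sort_up v else sort_down v.

(* Main.v *)
(* Replacing v by w = sgn(u.v) v makes the dot product positive and turns
   v^updown into w^up up to sign, so only increasing rearrangements matter.
   If v maximises u.v among its permutations, then transposing two entries of v
   cannot increase u.v, which says that u and v are similar; and similar vectors
   are sorted by a common permutation, so that u.v = u^up.v^up.  Hence u.v is at
   most u^up.v^up, with equality exactly for similar vectors.  The other bounds
   are Cauchy-Schwarz, applied to u^up and w^up, and AM-GM for the norms. *)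
Require Import Defs.
From HB Require Import structures.
From mathcomp Require Import all_boot all_order all_algebra.
From mathcomp Require Import all_fingroup.
From mathcomp Require Import reals.
From mathcomp Require Import ring lra.

Set Implicit Arguments.
Unset Strict Implicit.
Unset Printing Implicit Defensive.

Import Order.TTheory GRing.Theory Num.Theory.
Local Open Scope ring_scope.

Section Rearrangement.
Variables (R : realType) (d : nat).
Implicit Types (u v w : 'cV[R]_d) (s : 'S_d).

(** * Dot product, Euclidean norm and Cauchy-Schwarz *)

Lemma dotC u v : dot u v = dot v u.
Proof. by apply: eq_bigr => i _; rewrite mulrC. Qed.

Lemma dotDl u v w : dot (u + v) w = dot u w + dot v w.
Proof. by rewrite /dot -big_split; apply: eq_bigr => i _; rewrite mxE mulrDl. Qed.

Lemma dotZl a u v : dot (a *: u) v = a * dot u v.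
Proof. by rewrite /dot mulr_sumr; apply: eq_bigr => i _; rewrite mxE mulrA. Qed.

Lemma dotZr a u v : dot u (a *: v) = a * dot u v.
Proof. by rewrite dotC dotZl dotC. Qed.

Lemma dotNr u v : dot u (- v) = - dot u v.
Proof. by rewrite -scaleN1r dotZr mulN1r. Qed.

Lemma dot_row_perm s u v : dot (row_perm s u) (row_perm s v) = dot u v.
Proof.
rewrite /dot [RHS](reindex_inj (@perm_inj _ s)).
by apply: eq_bigr => i _; rewrite !mxE.
Qed.

Lemma dot_self_ge0 u : 0 <= dot u u.
Proof. by apply: sumr_ge0 => i _; rewrite -expr2 sqr_ge0. Qed.

Lemma dot_self_eq0 u : dot u u = 0 -> u = 0.
Proof.
move/psumr_eq0P => u0; apply/colP => i; rewrite mxE; apply/eqP.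
by rewrite -sqrf_eq0 expr2 u0 // => j _; rewrite -expr2 sqr_ge0.
Qed.

Lemma enormE u : enorm u = Num.sqrt (dot u u).
Proof. by []. Qed.

Lemma enorm_ge0 u : 0 <= enorm u.
Proof. exact: sqrtr_ge0. Qed.

Lemma sqr_enorm u : enorm u ^+ 2 = dot u u.
Proof. by rewrite enormE sqr_sqrtr ?dot_self_ge0. Qed.

Lemma enorm_row_perm s u : enorm (row_perm s u) = enorm u.
Proof. by rewrite !enormE dot_row_perm. Qed.

Lemma enormZ a u : enorm (a *: u) = `|a| * enorm u.
Proof.
by rewrite !enormE dotZl dotZr mulrA -expr2 sqrtrM ?sqr_ge0 // sqrtr_sqr.
Qed.

Lemma enorm_gt0 u v : dot u v != 0 -> 0 < enorm u.
Proof.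
move=> uv0; rewrite lt_neqAle enorm_ge0 andbT eq_sym.
apply: contra_neq uv0 => nu0.
have /dot_self_eq0 -> : dot u u = 0 by rewrite -sqr_enorm nu0 expr0n.
by rewrite -(scale0r 0) dotZl mul0r.
Qed.

(* The left-hand side is nonnegative and vanishes only for proportional vectors,
   which gives Cauchy-Schwarz together with its equality case. *)
Lemma dot_self_comb u v :
  dot (enorm v *: u + - enorm u *: v) (enorm v *: u + - enorm u *: v)
    = 2 * (enorm u * enorm v) * (enorm u * enorm v - dot u v).
Proof.
rewrite dotDl (dotC (enorm v *: u)) (dotC (- enorm u *: v)) !dotDl !dotZl !dotZr.
rewrite (dotC v u) -!sqr_enorm; ring.
Qed.

Lemma dot_le_enorm u v : 0 < dot u v -> dot u v <= enorm u * enorm v.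
Proof.
move=> uv0; have := dot_self_ge0 (enorm v *: u + - enorm u *: v).
have u0 : 0 < enorm u by apply: (@enorm_gt0 _ v); rewrite gt_eqF.
have v0 : 0 < enorm v by apply: (@enorm_gt0 _ u); rewrite dotC gt_eqF.
by rewrite dot_self_comb pmulr_rge0 ?subr_ge0 // !mulr_gt0.
Qed.

(** Equality makes the right-hand side of [dot_self_comb] vanish. The coefficient is explicit
    because later steps need its sign, and its value when the norms agree. *)
Lemma dot_eq_enorm u v : dot u v != 0 ->
  dot u v = enorm u * enorm v -> v = (enorm v / enorm u) *: u.
Proof.
move=> uv0 uvE; have := dot_self_comb u v; rewrite uvE subrr mulr0.
move/dot_self_eq0; rewrite scaleNr => /subr0_eq uvE'.
have /lt0r_neq0 u0 := enorm_gt0 uv0.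
by rewrite mulrC -scalerA uvE' scalerA mulVf ?scale1r.
Qed.

(** * Sorting as a permutation of the coordinates *)

Lemma perm_components_row_perm s u :
  perm_eq (components (row_perm s u)) (components u).
Proof.
have -> : components (row_perm s u) = [seq u i 0 | i <- map s (enum 'I_d)].
  by rewrite -map_comp; apply: eq_map => i /=; rewrite mxE.
apply: perm_map; apply: uniq_perm; rewrite ?enum_uniq //.
  by rewrite map_inj_uniq ?enum_uniq //; apply: perm_inj.
move=> i; rewrite mem_enum; apply/mapP; exists ((s^-1)%g i).
  by rewrite mem_enum.
by rewrite permKV.
Qed.

Lemma sort_up_row_perm s u : sort_up (row_perm s u) = sort_up u.
Proof.
by rewrite /sort_up; have /perm_sort_leP -> := perm_components_row_perm s u.
Qed.

Lemma sort_up_perm u : exists s, sort_up u = row_perm s u.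
Proof.
have /tuple_permP [s sE] :
    perm_eq (sort (fun x y : R => x <= y) (components u)) [tuple u i 0 | i < d].
  by rewrite perm_sort.
exists s; apply/colP => i; rewrite /sort_up !mxE sE.
by rewrite -tnth_nth !tnth_mktuple.
Qed.

Lemma enorm_sort_up u : enorm (sort_up u) = enorm u.
Proof. by have [s ->] := sort_up_perm u; rewrite enorm_row_perm. Qed.

(** Negation reverses the order, so both sides are non-increasing arrangements of [r], and
    antisymmetry leaves room for only one. *)
Lemma sort_opp (r : seq R) :
  sort (fun x y => y <= x) r
    = map -%R (sort (fun x y => x <= y) (map -%R r)).
Proof.
have ge_trans : transitive (fun x y : R => y <= x).
  by move=> y x z yx zy; apply: le_trans yx.
have ge_anti : antisymmetric (fun x y : R => y <= x).
  by move=> x y; rewrite andbC; apply: le_anti.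
apply: (sorted_eq ge_trans ge_anti).
- by apply: sort_sorted => x y; apply: le_total.
- rewrite sorted_map; apply: (@sub_sorted _ <=%R) => [x y|] /=.
    by rewrite lerN2.
  exact: sort_le_sorted.
rewrite perm_sort -[X in perm_eq X _](mapK (@opprK R)) perm_sym.
by apply: perm_map; rewrite perm_sort.
Qed.

Lemma size_components u : size (components u) = d.
Proof. by rewrite size_map size_enum_ord. Qed.

Lemma sort_down_opp u : sort_down u = - sort_up (- u).
Proof.
apply/colP => i; rewrite !mxE sort_opp.
rewrite (nth_map 0); last by rewrite size_sort size_map size_components.
rewrite -map_comp; congr (- nth 0 (sort _ _) i).
by apply: eq_map => j /=; rewrite mxE.
Qed.

(* Similarity says exactly that the componentwise order on the pairs
   [(u_i, v_i)] is total, so one arrangement of the indices sorts both. *)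
Lemma dot_sort_similar u v :
  similar_vectors u v -> dot (sort_up u) (sort_up v) = dot u v.
Proof.
move=> simuv.
pose r := [rel i j : 'I_d | (u i 0 <= u j 0) && (v i 0 <= v j 0)].
have r_total : total r.
  move=> i j /=; have := simuv i j.
  have [uij|uij|->] := ltgtP (u i 0) (u j 0); rewrite ?lexx /=; last first.
  - by move=> _; apply: le_total.
  - by rewrite pmulr_rge0 ?subr_gt0 // subr_ge0.
  - by rewrite nmulr_rge0 ?subr_lt0 // subr_le0 orbF.
pose l := sort r (enum 'I_d).
have sl : size l = d by rewrite size_sort size_enum_ord.
have sortE w : (forall i j, r i j -> w i 0 <= w j 0) ->
    sort (fun x y : R => x <= y) (components w) = [seq w i 0 | i <- l].
  move=> rw; have /perm_sort_leP -> : perm_eq (components w) [seq w i 0 | i <- l].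
    by apply: perm_map; rewrite perm_sym perm_sort.
  apply/sort_le_id; rewrite sorted_map.
  by apply: (sub_sorted rw); apply: sort_sorted.
pose F i := u i 0 * v i 0.
transitivity (\sum_(i < d) nth 0 [seq F i | i <- l] i).
  apply: eq_bigr => i _; rewrite !mxE !sortE; try by move=> ? ? /andP[].
  (* The ordinal [i] itself serves as the default for [l], because ['I_d] has no element valid for
     every [d]; it is never reached, as [l] has size [d]. *)
  by rewrite !(nth_map i) ?sl.
have -> : \sum_(i < d) nth 0 [seq F i | i <- l] i
        = \sum_(x <- [seq F i | i <- l]) x.
  by rewrite (big_nth 0) size_map sl big_mkord.
by rewrite big_map (perm_big (enum 'I_d)) ?perm_sort // big_enum.
Qed.

(** * The rearrangement inequality and its equality cases *)

Lemma dot_tperm u v i j :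
  dot u (row_perm (tperm i j) v)
    = dot u v - (u i 0 - u j 0) * (v i 0 - v j 0).
Proof.
have [<-|ij] := eqVneq i j; first by rewrite tperm1 row_perm1 !subrr mul0r subr0.
have ji : j != i by rewrite eq_sym.
rewrite /dot (bigD1 i) //= (bigD1 j) //=.
rewrite [in RHS](bigD1 i) //= [in RHS](bigD1 j) //=.
rewrite !mxE tpermL tpermR.
rewrite [X in _ + (_ + X) = _](eq_bigr (fun k => u k 0 * v k 0)); first by ring.
by move=> k /andP[ki kj]; rewrite mxE tpermD // eq_sym.
Qed.

Lemma similar_of_max u v :
  (forall s, dot u (row_perm s v) <= dot u v) -> similar_vectors u v.
Proof.
by move=> max_v i j; have := max_v (tperm i j); rewrite dot_tperm gerBl.
Qed.

Lemma dot_le_sort_up u v : dot u v <= dot (sort_up u) (sort_up v).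
Proof.
have [s _ max_s] := @arg_maxP _ R _ 1%g xpredT (fun s => dot u (row_perm s v)) isT.
have /dot_sort_similar : similar_vectors u (row_perm s v).
  by apply: similar_of_max => t; rewrite -row_permM; apply: max_s.
rewrite sort_up_row_perm => ->.
by rewrite -[X in dot _ X <= _]row_perm1; apply: max_s.
Qed.

(** All permutations of [v] share its sorted form, hence the same upper bound; if [v] attains it,
    [v] is a maximiser. *)
Lemma dot_eq_sort_up u v :
  dot u v = dot (sort_up u) (sort_up v) <-> similar_vectors u v.
Proof.
split=> [uvE|/dot_sort_similar //]; apply: similar_of_max => s.
by rewrite uvE -(sort_up_row_perm s v) dot_le_sort_up.
Qed.

Lemma sort_up_eq_enorm u w : 0 < dot u w ->
  dot (sort_up u) (sort_up w) = enorm u * enorm w <->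
  exists (k : R) (P : 'M[R]_d), [/\ is_perm_mx P, w = k *: (P *m u) & 0 < k].
Proof.
move=> uw0; split.
  have suw0 := lt_le_trans uw0 (dot_le_sort_up u w).
  rewrite -[enorm u]enorm_sort_up -[enorm w]enorm_sort_up.
  move/(dot_eq_enorm (lt0r_neq0 suw0)); rewrite !enorm_sort_up.
  have [[s ->] [t ->]] := (sort_up_perm u, sort_up_perm w) => wE.
  (* The sorted vectors are proportional: [s] sorts [u], and the inverse of [t] takes the sorted [w]
     back to [w]. *)
  exists (enorm w / enorm u), (perm_mx (t^-1 * s)%g); split.
  - exact: perm_mx_is_perm.
  - rewrite -[w in LHS](row_perm1) -(mulVg t) row_permM wE.
    by rewrite -row_permE row_permM; apply/colP => i; rewrite !mxE.
  - rewrite divr_gt0 //; first by apply: (@enorm_gt0 _ u); rewrite dotC gt_eqF.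
    by apply: (@enorm_gt0 _ w); rewrite gt_eqF.
case=> k [P [/is_perm_mxP[s ->] wE k0]].
move: uw0 wE; rewrite -row_permE => uw0 wE; apply/eqP; rewrite eq_le.
rewrite -[enorm u]enorm_sort_up -[enorm w]enorm_sort_up.
rewrite dot_le_enorm ?(lt_le_trans uw0) ?dot_le_sort_up //= !enorm_sort_up.
(* [row_perm s u] is already aligned with [w] and has the same sorted form as
   [u]. *)
apply: le_trans (_ : dot (row_perm s u) w <= _); last first.
  by rewrite -(sort_up_row_perm s u) dot_le_sort_up.
rewrite wE enormZ enorm_row_perm dotZr dot_row_perm gtr0_norm //.
by rewrite -sqr_enorm mulrCA expr2.
Qed.

End Rearrangement.

(** * The arithmetic-geometric mean inequality *)

Lemma amgm_eq (F : realFieldType) (a b : F) :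
  a * b = 2^-1 * (a ^+ 2 + b ^+ 2) <-> a = b.
Proof.
have abE : (a - b) ^+ 2 = 2 * (2^-1 * (a ^+ 2 + b ^+ 2) - a * b) by field.
split=> [/eqP|->]; last by field.
rewrite eq_sym -subr_eq0 => /eqP ab0; apply/eqP; rewrite -subr_eq0 -sqrf_eq0.
by rewrite abE ab0 mulr0.
Qed.

Lemma amgm_le (F : realFieldType) (a b : F) :
  a * b <= 2^-1 * (a ^+ 2 + b ^+ 2).
Proof. have := sqr_ge0 (a - b); nra. Qed.

(** Equality between the ends of a chain forces equality at each link. This reduces cases (3) and
    (5) to cases (2) and (4) together with equal norms. *)
Lemma amgm_chain_eq (F : realFieldType) (x a b : F) : x <= a * b ->
  x = 2^-1 * (a ^+ 2 + b ^+ 2) <-> x = a * b /\ a = b.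
Proof.
move=> xab; split=> [xE|[-> /amgm_eq //]].
have xabE : x = a * b by apply/le_anti; rewrite xab xE amgm_le.
by split=> //; apply/amgm_eq; rewrite -xabE.
Qed.

Theorem theorem1 (R : realType) (d : nat) (hd : (1 <= d)%N)
    (u v : 'cV[R]_d) (huv : dot u v <> 0) :
  (`|dot u v| <= `|dot (sort_up u) (sort_updown u v)|
   /\ `|dot (sort_up u) (sort_updown u v)| <= enorm u * enorm v
   /\ enorm u * enorm v <= 2^-1 * (enorm u ^+ 2 + enorm v ^+ 2))
  /\ (`|dot u v| = `|dot (sort_up u) (sort_updown u v)| <->
      (0 < dot u v /\ similar_vectors u v)
      \/ (dot u v < 0 /\ discordant_vectors u v))
  /\ (`|dot u v| = enorm u * enorm v <-> exists k : R, v = k *: u)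
  /\ (`|dot u v| = 2^-1 * (enorm u ^+ 2 + enorm v ^+ 2) <->
      u = v \/ u = - v)
  /\ (`|dot (sort_up u) (sort_updown u v)| = enorm u * enorm v <->
      exists (k : R) (P : 'M[R]_d),
        is_perm_mx P /\ v = k *: (P *m u) /\ Num.sg (dot u v) = Num.sg k)
  /\ (`|dot (sort_up u) (sort_updown u v)|
        = 2^-1 * (enorm u ^+ 2 + enorm v ^+ 2) <->
      exists (k : R) (P : 'M[R]_d),
        (k = 1 \/ k = -1) /\ is_perm_mx P /\ v = k *: (P *m u)
        /\ Num.sg (dot u v) = Num.sg k)
  /\ (enorm u * enorm v = 2^-1 * (enorm u ^+ 2 + enorm v ^+ 2) <->
      enorm u = enorm v).
Proof.
set e := Num.sg (dot u v); pose w := e *: v.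
have uv0 : dot u v != 0 by apply/eqP.
have ee : e * e = 1 by rewrite -expr2 sqr_sg uv0.
have eP : 0 < dot u v /\ e = 1 \/ dot u v < 0 /\ e = -1.
  case: (ltgtP (dot u v) 0) uv0 => // uv_sg _; [right|left]; split=> //.
    exact: ltr0_sg.
  exact: gtr0_sg.
have vE : v = e *: w by rewrite scalerA ee scale1r.
have uvE : `|dot u v| = dot u w by rewrite dotZr normrEsg.
have uw0 : 0 < dot u w by rewrite -uvE normr_gt0.
have suvE : `|dot (sort_up u) (sort_updown u v)| = dot (sort_up u) (sort_up w).
  have suw0 := lt_le_trans uw0 (dot_le_sort_up u w).
  rewrite -[RHS]gtr0_norm // /sort_updown /w.
  case: eP => -[uv_sg ->]; first by rewrite uv_sg scale1r.
  (* Here [w = - v], so the decreasing sort of [v] is minus the increasing sort of [w], and the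
     absolute value absorbs the sign. *)
  rewrite (lt_gtF uv_sg).
  by rewrite scaleN1r sort_down_opp dotNr normrN.
have nwE : enorm w = enorm v.
  by rewrite enormZ normr_sg uv0 mul1r.
have le2 : dot (sort_up u) (sort_up w) <= enorm u * enorm w.
  rewrite -[enorm u]enorm_sort_up -[enorm w]enorm_sort_up.
  by rewrite dot_le_enorm // (lt_le_trans uw0) ?dot_le_sort_up.
have cs_eq : dot u w = enorm u * enorm w <-> exists k : R, v = k *: u.
  split=> [/(dot_eq_enorm (lt0r_neq0 uw0)) wE|[k vkE]].
    by exists (e * (enorm w / enorm u)); rewrite vE {1}wE scalerA.
  by rewrite -uvE nwE vkE dotZr enormZ normrM mulrCA -expr2 sqr_enorm
             (ger0_norm (dot_self_ge0 u)).
have sort_eq : dot (sort_up u) (sort_up w) = enorm u * enorm w <->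
    exists (k : R) (P : 'M[R]_d),
      is_perm_mx P /\ v = k *: (P *m u) /\ e = Num.sg k.
  (* Passing between [v] and [w] multiplies the scalar by [e], in both directions since [e * e = 1];
     the condition that [k] has sign [e] becomes positivity of [e * k]. *)
  rewrite sort_up_eq_enorm //; split=> -[k [P]].
    case=> permP wE k0; exists (e * k), P; split=> //; split.
      by rewrite vE wE scalerA.
    by rewrite sgrM (gtr0_sg k0) mulr1 /e sgr_id.
  case=> permP [vkE ek]; exists (e * k), P; split=> //.
    by rewrite /w vkE scalerA.
  by rewrite ek -normrEsg normr_gt0 -sgr_eq0 -ek sgr_eq0.
rewrite uvE suvE -nwE.
split; first by rewrite dot_le_sort_up le2 amgm_le.
split.
  rewrite dot_eq_sort_up /similar_vectors /discordant_vectors /w.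
  (* Negating [v] exchanges similar and discordant. *)
  have discE (x : R) i j :
      x * ((-1 *: v) i 0 - (-1 *: v) j 0) = - (x * (v i 0 - v j 0)).
    by rewrite !mxE; ring.
  case: eP => -[uv_sg ->].
    rewrite scale1r; split=> [sim|[[_ //]|[]]]; first by left.
    by rewrite (lt_gtF uv_sg).
  split=> [sim|]; last first.
    by case=> [[]|[_ disc] i j]; rewrite ?(lt_gtF uv_sg) // discE oppr_ge0.
  by right; split=> // i j; rewrite -oppr_ge0 -discE; apply: sim.
split; first exact: cs_eq.
split.
  rewrite amgm_chain_eq ?(le_trans (dot_le_sort_up u w)) //; split.
    case=> /(dot_eq_enorm (lt0r_neq0 uw0)) wE uwE.
    have u0 : enorm u != 0 by apply/lt0r_neq0/(@enorm_gt0 _ _ _ w)/lt0r_neq0.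
    (* Equal norms make the proportionality factor 1, so [w = u] and [v = e *: u]. *)
    rewrite vE wE -uwE divff // scale1r.
    by case: eP => -[_ ->]; [left|right]; rewrite ?scale1r ?scaleN1r ?opprK.
  move=> uvN; split; last by rewrite nwE; case: uvN => ->;
    rewrite // -scaleN1r enormZ normrN1 mul1r.
  apply/cs_eq; case: uvN => ->; first by exists 1; rewrite scale1r.
  by exists (-1); rewrite scaleN1r opprK.
split; first exact: sort_eq.
split; last exact: amgm_eq.
rewrite amgm_chain_eq // sort_eq; split.
  case=> -[k [P [permP [vkE ek]]]] uwE; exists k, P; split=> //.
  (* A permutation preserves the norm, so equal norms of [u] and [v] leave only the sign of [k]
     free. *)
  have k1 : `|k| = 1.
    have u0 : enorm u != 0 by apply/lt0r_neq0/(@enorm_gt0 _ _ _ w)/lt0r_neq0.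
    apply: (mulIf u0); rewrite mul1r {2}uwE nwE vkE enormZ.
    by case/is_perm_mxP: permP => s ->; rewrite -row_permE enorm_row_perm.
  by rewrite -[k]mulr_sg_norm k1 mulr1 -ek; case: eP => -[_ ->]; [left|right].
case=> k [P [k1 [permP [vkE ek]]]]; split; first by exists k, P.
rewrite nwE vkE enormZ; case/is_perm_mxP: permP => s ->.
rewrite -row_permE enorm_row_perm.
by case: k1 => ->; rewrite ?normrN1 ?normr1 mul1r.
Qed.
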